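(* Let $R$ be a unital non-associative ring (with $1\ne 0$), let $I$ be a well-ordered set, and let $\Delta=\{\delta_i\}_{i\in I}$ be a family of additive maps $\delta_i:R\to R$ with $\delta_i(1)=0$. Suppose that $\Delta$ is commutative and is a set of left kernel derivations on $R$, or that $\Delta$ is commutative and is a set of right kernel derivations on $R$. Then the differential monoid ring $S=R[\mathbb{N}^{(I)};\pi]$ is simple if and only if $R$ is $\Delta$-simple and $Z(S)$ is a field.
   Context: ''Non-associative'' means not necessarily associative: a unital non-associative ring is an additive abelian group with a biadditive multiplication and a two-sided identity $1$. Ideals are two-sided; a ring is simple if its only ideals are $\{0\}$ and itself. $\mathbb{N}$ is the set of non-negative integers. $\mathbb{N}^{(I)}$ is the commutative monoid (under pointwise addition) of functions $f:I\to\mathbb{N}$ with finite support; $f\le g$ means $f(i)\le g(i)$ for all $i\in I$; $\binom{f}{g}=\prod_{i\in I}\binom{f(i)}{g(i)}$, where $\binom{m}{n}=0$ if $m<n$. $R_\Delta=\bigcap_{i\in I}\ker(\delta_i)$. $\Delta$ is commutative if $\delta_i\circ\delta_j=\delta_j\circ\delta_i$ for all $i,j\in I$. $\Delta$ is a set of left (right) kernel derivations on $R$ if each $\delta_i$ is left (right) $R_\Delta$-linear, i.e. $\delta_i(kr)=k\delta_i(r)$ (respectively $\delta_i(rk)=\delta_i(r)k$) for all $k\in R_\Delta$, $r\in R$. $R$ is $\Delta$-simple if $\{0\}$ and $R$ are the only ideals $J$ of $R$ with $\delta_i(J)\subseteq J$ for all $i\in I$. For $f\in\mathbb{N}^{(I)}$,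 $\delta^f$ denotes the composition of the maps $\delta_i^{f(i)}$ over $i$ in the support of $f$ (with $\delta^0=\mathrm{id}_R$), and for $f,g\in\mathbb{N}^{(I)}$, $\pi^f_g=\binom{f}{g}\delta^{f-g}$ if $g\le f$ and $\pi^f_g=0$ otherwise. $S=R[\mathbb{N}^{(I)};\pi]$ is the set of formal finite sums $\sum_{f\in\mathbb{N}^{(I)}}r_fx^f$ ($r_f\in R$) with pointwise addition and biadditive multiplication determined by $(rx^f)(sx^g)=\sum_{h\in\mathbb{N}^{(I)}}r\,\pi^f_h(s)\,x^{h+g}$. The center $Z(S)$ is the set of $s\in S$ with $st=ts$ and $(s,t,u)=(t,s,u)=(t,u,s)=0$ for all $t,u\in S$, where $(u,v,w)=(uv)w-u(vw)$. *)

(* Defs.v *)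
From HB Require Import structures.
From mathcomp Require Import all_boot all_order all_algebra finmap all_classical.
From mathcomp Require Import monalg.

Set Implicit Arguments.
Unset Strict Implicit.
Unset Printing Implicit Defensive.

Import Order.TTheory GRing.Theory.

Local Open Scope classical_set_scope.
Local Open Scope ring_scope.

Local Notation "1" := (@mone _) : monom_scope.
Local Notation "f * g" := (mmul f g) : monom_scope.

(* Unital, not necessarily associative rings.  The multiplication and its unit
   are those of the unital magma, hence written [(x * y)%g] and [1%g]; the
   condition [1 != 0] is not part of the structure. *)
HB.mixin Record UMagma_isBiadditive R of GRing.Zmodule R & UMagma R := {
  namulDl : forall x y z : R, ((x + y) * z)%g = (x * z)%g + (y * z)%g;
  namulDr : forall x y z : R, (x * (y + z))%g = (x * y)%g + (x * z)%g
}.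

#[short(type="naRingType")]
HB.structure Definition NaRing :=
  {R of GRing.Zmodule R & UMagma R & UMagma_isBiadditive R}.

Section NaRingTheory.
Context {R : naRingType}.
Implicit Types (x y z : R) (J K : set R).

Lemma namul0r x : (0 * x)%g = 0 :> R.
Proof. by apply: (addrI (0 * x)%g); rewrite -namulDl !addr0. Qed.

Lemma namulr0 x : (x * 0)%g = 0 :> R.
Proof. by apply: (addrI (x * 0)%g); rewrite -namulDr !addr0. Qed.

Definition associator x y z : R := (x * y * z)%g - (x * (y * z))%g.

Definition is_ideal J : Prop :=
  [/\ J 0, forall x y, J x -> J y -> J (x - y)
    & forall r x, J x -> J (r * x)%g /\ J (x * r)%g].

Definition center : set R :=
  [set s | forall t u : R,
     [/\ (s * t)%g = (t * s)%g, associator s t u = 0,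
         associator t s u = 0 & associator t u s = 0]].

Definition is_subring K : Prop :=
  [/\ K 1%g, forall x y, K x -> K y -> K (x - y)
    & forall x y, K x -> K y -> K (x * y)%g].

(* K is a field for the operations inherited from R. *)
Definition is_field K : Prop :=
  [/\ is_subring K, (1%g : R) <> 0,
      forall x y z, K x -> K y -> K z -> (x * (y * z))%g = (x * y * z)%g,
      forall x y, K x -> K y -> (x * y)%g = (y * x)%g
    & forall x, K x -> x <> 0 -> exists2 y, K y & (x * y)%g = 1%g].

End NaRingTheory.

Arguments center : clear implicits.

Definition is_simple (R : naRingType) : Prop :=
  forall J : set R, is_ideal J -> J = [set 0] \/ J = setT.

(* {cmonom I} is the monoid of finitely supported functions I -> nat, written
   multiplicatively: [(f * g)%M] is the pointwise sum, [1%M] the zero function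
   and [divcm f g] the pointwise (truncated) difference. *)
Section Exponents.
Context {I : choiceType}.
Implicit Types f g : {cmonom I}.

Definition mle f g : Prop := forall i, (f i <= g i)%N.

(* Outside the two supports the factors are 'C(0, 0) = 1. *)
Definition mbinom f g : nat :=
  (\prod_(i <- (finsupp f `|` finsupp g)%fset) 'C(f i, g i))%N.

Lemma finite_mle f : finite_set [set h | mle h f].
Proof.
pose F (p : {ffun finsupp f -> 'I_(mdeg f).+1}) : {cmonom I} :=
  mkcmonom [fsfun i : finsupp f => nat_of_ord (p i) | 0%N].
apply: (@sub_finite_set _ _ (F @` setT)); last exact/finite_image/finite_finset.
move=> h hf; exists [ffun i => inord (h (val i))] => //.
apply/eqP/cmP => i; rewrite cmE fsfun_ffun.
case: insubP => /= [u _ uE|].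
  rewrite ffunE inordK ?uE// ltnS (leq_trans (hf i))//.
  have if_ : i \in finsupp f by rewrite -uE; exact: valP.
  by rewrite mdegE (big_fsetD1 i)//= leq_addr.
rewrite -cmE_eq0 => /eqP fi0.
by move: (hf i); rewrite fi0 leqn0 => /eqP ->.
Qed.

End Exponents.

Section DifferentialFamily.
Context {d : Order.disp_t} {I : orderType d} {R : naRingType}.
Context (delta : I -> {additive R -> R}).
Implicit Types (f g h : {cmonom I}) (r s : R).

Definition kernel : set R := \bigcap_i (delta i @^-1` [set 0]).

Definition commutative_family : Prop :=
  forall i j, delta i \o delta j =1 delta j \o delta i.

Definition left_kernel_derivations : Prop :=
  forall i k r, kernel k -> delta i (k * r)%g = (k * delta i r)%g.

Definition right_kernel_derivations : Prop :=
  forall i k r, kernel k -> delta i (r * k)%g = (delta i r * k)%g.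

Definition delta_simple : Prop :=
  forall J : set R, is_ideal J -> (forall i, delta i @` J `<=` J) ->
    J = [set 0] \/ J = setT.

(* The factors are composed in the order of I, the least index outermost; the
   order is immaterial for a commutative family. *)
Definition dpow f r : R :=
  foldr (fun i => iter (f i) (delta i)) r (sort <=%O (finsupp f)).

Definition dpi f g r : R :=
  if `[< mle g f >] then dpow (divcm f g) r *+ mbinom f g else 0.

Lemma dpowB f : {morph dpow f : r s / r - s}.
Proof.
rewrite /dpow => r s; elim: (sort _ _) => //= i l ->.
by elim: (f i) => //= n ->; rewrite raddfB.
Qed.

Lemma dpiB f g : {morph dpi f g : r s / r - s}.
Proof.
by move=> r s; rewrite /dpi; case: ifP; rewrite ?subr0// dpowB mulrnBl.
Qed.

HB.instance Definition _ f g := GRing.isZmodMorphism.Build R R (dpi f g) (dpiB f g).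

Lemma dpi_out f g r : ~ mle g f -> dpi f g r = 0.
Proof. by rewrite /dpi; case: asboolP. Qed.

Lemma dpow0 r : dpow 1%M r = r.
Proof. by rewrite /dpow mdom1. Qed.

Lemma dpi_id f r : dpi f f r = r.
Proof.
rewrite /dpi asboolT//.
have -> : divcm f f = 1%M.
  by apply/eqP/cmP => i; rewrite divcmE cm1 subnn.
by rewrite dpow0 /mbinom big1// => i _; rewrite binn.
Qed.

(* The product (r x^f)(s x^g), where r x^f is << r *g f >>.  Only finitely many
   exponents h contribute, by finite_mle. *)
Definition dterm r f s g : {malg R[{cmonom I}]} :=
  \sum_(h \in [set: {cmonom I}]) << (r * dpi f h s)%g *g (h * g)%M >>.

Definition dmul (a b : {malg R[{cmonom I}]}) : {malg R[{cmonom I}]} :=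
  \sum_(f <- msupp a) \sum_(g <- msupp b) dterm a@_f f b@_g g.

Lemma dtermE r f s g :
  dterm r f s g =
  \sum_(h <- fset_set [set h | mle h f]) << (r * dpi f h s)%g *g (h * g)%M >>.
Proof.
rewrite /dterm (@fsbigTE _ _ _ _ (fset_set [set h | mle h f]))// => h.
rewrite in_fset_set; last exact: finite_mle.
by move/negP; rewrite inE => /dpi_out ->; rewrite namulr0 monalgU0.
Qed.

Lemma dterm0r f s g : dterm 0 f s g = 0.
Proof. by rewrite dtermE big1// => h _; rewrite namul0r monalgU0. Qed.

Lemma dtermr0 r f g : dterm r f 0 g = 0.
Proof. by rewrite dtermE big1// => h _; rewrite raddf0 namulr0 monalgU0. Qed.

Lemma dtermDl r1 r2 f s g :
  dterm (r1 + r2) f s g = dterm r1 f s g + dterm r2 f s g.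
Proof.
by rewrite !dtermE -big_split/=; apply: eq_bigr => h _; rewrite namulDl monalgUD.
Qed.

Lemma dtermDr r f s1 s2 g :
  dterm r f (s1 + s2) g = dterm r f s1 g + dterm r f s2 g.
Proof.
by rewrite !dtermE -big_split/=; apply: eq_bigr => h _;
  rewrite raddfD namulDr monalgUD.
Qed.

Lemma dmulw (A B : {fset {cmonom I}}) a b :
  (msupp a `<=` A)%fset -> (msupp b `<=` B)%fset ->
  dmul a b = \sum_(f <- A) \sum_(g <- B) dterm a@_f f b@_g g.
Proof.
move=> aA bB; rewrite /dmul (big_fset_incl _ aA)/=.
  apply: eq_bigr => f _; apply: (big_fset_incl _ bB) => g _ /mcoeff_outdom b0.
  by rewrite b0 dtermr0.
move=> f _ /mcoeff_outdom a0; rewrite big1// => g _.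
by rewrite a0 dterm0r.
Qed.

Lemma dmulDl : left_distributive dmul +%R.
Proof.
move=> a b c.
rewrite (dmulw (msuppD_le a b) (fsubset_refl _)).
rewrite (dmulw (fsubsetUl _ (msupp b)) (fsubset_refl (msupp c))).
rewrite (dmulw (fsubsetUr (msupp a) _) (fsubset_refl (msupp c))).
rewrite -big_split/=; apply: eq_bigr => f _.
by rewrite -big_split/=; apply: eq_bigr => g _; rewrite mcoeffD dtermDl.
Qed.

Lemma dmulDr : right_distributive dmul +%R.
Proof.
move=> c a b.
rewrite (dmulw (fsubset_refl _) (msuppD_le a b)).
rewrite (dmulw (fsubset_refl (msupp c)) (fsubsetUl _ (msupp b))).
rewrite (dmulw (fsubset_refl (msupp c)) (fsubsetUr (msupp a) _)).
rewrite -big_split/=; apply: eq_bigr => f _.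
by rewrite -big_split/=; apply: eq_bigr => g _; rewrite mcoeffD dtermDr.
Qed.

Lemma dmulUU r f s g : dmul << r *g f >> << s *g g >> = dterm r f s g.
Proof. by rewrite (dmulw msuppU_le msuppU_le) !big_seq_fset1 !mcoeffUU. Qed.

Definition dmone : {malg R[{cmonom I}]} := << 1%g *g 1%M >>.

Lemma dmul1 : left_id dmone dmul.
Proof.
move=> a; rewrite (dmulw msuppU_le (fsubset_refl _)) big_seq_fset1 mcoeffUU.
rewrite [RHS]monalgE; apply: eq_bigr => g _.
rewrite /dterm (@fsbigTE _ _ _ _ [fset 1%M]%fset).
  by rewrite big_seq_fset1 dpi_id mul1g mul1m.
move=> h; rewrite inE => /eqP h1; rewrite dpi_out ?namulr0 ?monalgU0// => h0.
apply: h1; apply/eqP/cmP => i; move: (h0 i).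
by rewrite cm1 leqn0 => /eqP.
Qed.

Context (delta1 : forall i, delta i 1%g = 0).

Lemma dpow1_eq0 f : f != 1%M -> dpow f 1%g = 0.
Proof.
move=> f1; have iter0 n i : iter n (delta i) 0 = 0.
  by elim: n => //= n ->; rewrite raddf0.
rewrite /dpow; have : sort <=%O (finsupp f) != [::] :> seq I.
  apply: contra_neq f1 => s0; apply/eqP/cmP => i.
  by rewrite cm1; apply/eqP; rewrite cmE_eq0 -(mem_sort <=%O) s0.
have : {subset sort <=%O (finsupp f) <= finsupp f}.
  by move=> i; rewrite mem_sort.
elim: (sort _ _) => //= i [|j l] IH sub _.
  have : i \in finsupp f by apply: sub; rewrite inE.
  rewrite -cmE_neq0; case: (f i) => //= n _.
  by elim: n => [|n /= ->]; [exact: delta1|exact: raddf0].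
rewrite IH//; first by move=> k kl; apply: sub; rewrite inE kl orbT.
Qed.

Lemma dmulr1 : right_id dmone dmul.
Proof.
move=> a; rewrite (dmulw (fsubset_refl _) msuppU_le) [RHS]monalgE.
apply: eq_bigr => f _; rewrite big_seq_fset1 mcoeffUU.
rewrite /dterm (@fsbigTE _ _ _ _ [fset f]%fset).
  by rewrite big_seq_fset1 dpi_id mulg1 mulm1.
move=> h; rewrite inE => hf; suff -> : dpi f h 1%g = 0 by rewrite namulr0 monalgU0.
rewrite /dpi; case: asboolP => // le_hf; rewrite dpow1_eq0 ?mul0rn//.
apply: contra_neq hf => fh1; apply/eqP/cmP => i; apply/eqP.
rewrite eqn_leq le_hf/= -subn_eq0 -divcmE fh1.
by rewrite cm1.
Qed.

End DifferentialFamily.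

(* The differential monoid ring R[N^(I); pi] of a family delta with
   delta_i(1) = 0, the latter being needed for 1 x^0 to be a right unit. *)
Definition diffMonoidRing (d : Order.disp_t) (I : orderType d) (R : naRingType)
    (delta : I -> {additive R -> R}) (delta1 : forall i, delta i 1%g = 0) : Type :=
  {malg R[{cmonom I}]}.

Section DiffMonoidRing.
Context {d : Order.disp_t} {I : orderType d} {R : naRingType}.
Context (delta : I -> {additive R -> R}) (delta1 : forall i, delta i 1%g = 0).

Local Notation S := (diffMonoidRing delta1).

HB.instance Definition _ := GRing.Zmodule.on S.
HB.instance Definition _ := hasMul.Build S (dmul delta).
HB.instance Definition _ :=
  Magma_isUMagma.Build S (dmul1 delta) (dmulr1 delta1).
HB.instance Definition _ :=
  UMagma_isBiadditive.Build S (dmulDl delta) (dmulDr delta).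

End DiffMonoidRing.

(* Main.v *)
Require Import Defs.
From mathcomp Require Import all_boot all_order all_algebra all_classical.
From HB Require Import structures.
From mathcomp Require Import wochoice finmap monalg.

(** Write [C r] for the constant [r x^0], [X f] for [1 x^f] and [x_i] for the
    variable [X U_(i)], so that [r x^f] is the product of [C r] and [X f].

    Simplicity of [S] passes to the right-hand side by standard means: the
    elements with all coefficients in a Delta-invariant ideal of [R] form an
    ideal of [S] ([simple_delta_simple]), and the centre of a simple ring is a
    field ([simple_center_field]).

    Conversely, let [J] be a nonzero ideal of [S].  Among the finite sets [D] of
    exponents that are closed downwards for pointwise comparison and contain
    the support of a nonzero element of [J], take one of least cardinality, and
    let [m] be a maximal element of [D].  Deleting [m] from [D] leaves a
    downward closed set, so an element of [J] supported in [D] is determined by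
    its coefficient at [m] ([minimal_support]).  The elements of [J] supported
    in [D] are stable under multiplication by constants on either side and under
    the commutators with the variables [x_i]; on coefficients at [m], these
    operations are the multiplications by elements of [R] and the maps
    [delta_i].  Hence these coefficients form a nonzero Delta-invariant ideal
    of [R], and since [R] is Delta-simple, some [a] in [J] supported in [D] has
    coefficient [1] at [m].

    This [a] is central ([monic_central]).  Comparing coefficients at [m] shows
    that [a] commutes with the constants, that the associators of [a] with two
    constants on its right, or with one on each side, vanish, and that
    [delta_i] kills every coefficient of [a].  These relations spread to all of
    [S]: the powers [X f] lie in the right nucleus because [delta_i(1) = 0]
    ([X_right_nucleus]) and in the middle nucleus by Pascal's rule and the
    commutativity of Delta ([X_middle_nucleus]), and the kernel derivation
    property says that left multiplication by [x_i] commutes with left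
    multiplication by [a] ([XU_central]).  As the centre is a field, the nonzero
    element [a] of [J] is invertible, and [J] is all of [S]. *)

Set Implicit Arguments.
Unset Strict Implicit.
Unset Printing Implicit Defensive.

Import Order.TTheory GRing.Theory.

Local Open Scope classical_set_scope.
Local Open Scope ring_scope.

Local Notation "1" := (@mone _) : monom_scope.
Local Notation "f * g" := (mmul f g) : monom_scope.
Local Notation "'U_(' i )" := (ucm i) : monom_scope.

(** * Ideals and centre of a non-associative ring *)

Section NonAssociative.
Context {A : naRingType}.
Implicit Types (s t u v : A) (J : set A).

Lemma namulBl u v t : ((u - v) * t)%g = (u * t)%g - (v * t)%g.
Proof. by apply: (addIr (v * t)%g); rewrite -namulDl !subrK. Qed.

Lemma namulBr t u v : (t * (u - v))%g = (t * u)%g - (t * v)%g.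
Proof. by apply: (addIr (t * v)%g); rewrite -namulDr !subrK. Qed.

Lemma namulMnr t u n : (t * (u *+ n))%g = (t * u)%g *+ n.
Proof. by elim: n => [|n IH]; rewrite ?namulr0// !mulrS namulDr IH. Qed.

Lemma namul_suml (T : Type) (r : seq T) (F : T -> A) t :
  ((\sum_(i <- r) F i) * t)%g = \sum_(i <- r) (F i * t)%g.
Proof.
by apply: (big_morph (fun u => (u * t)%g)) => [u v|]; rewrite ?namulDl ?namul0r.
Qed.

Lemma namul_sumr (T : Type) (r : seq T) (F : T -> A) t :
  (t * \sum_(i <- r) F i)%g = \sum_(i <- r) (t * F i)%g.
Proof.
by apply: (big_morph (fun u => (t * u)%g)) => [u v|]; rewrite ?namulDr ?namulr0.
Qed.

Lemma idealD J u v : is_ideal J -> J u -> J v -> J (u + v).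
Proof.
case=> J0 JB _ Ju Jv; rewrite -(opprK v); apply: (JB) => //.
by rewrite -sub0r; apply: JB.
Qed.

Lemma ideal_sum J (T : Type) (r : seq T) (F : T -> A) :
  is_ideal J -> (forall i, J (F i)) -> J (\sum_(i <- r) F i).
Proof.
move=> idJ JF; apply: (big_ind J) => //; first by case: idJ.
by move=> u v; apply: idealD.
Qed.

Lemma ideal1 J : is_ideal J -> J 1%g -> J = setT.
Proof.
case=> _ _ JM J1; apply/seteqP; split=> // u _.
by rewrite -(mulg1 u); case: (JM u 1%g J1).
Qed.

Lemma centerP s : center A s <->
  [/\ forall t, (s * t)%g = (t * s)%g,
      forall t u, (s * t * u)%g = (s * (t * u))%g,
      forall t u, (t * s * u)%g = (t * (s * u))%g
    & forall t u, (t * u * s)%g = (t * (u * s))%g].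
Proof.
split=> [Zs|[C1 C2 C3 C4] t u]; last by rewrite /associator C2 C3 C4 !subrr C1.
split=> [t|t u|t u|t u]; first by case: (Zs t t).
all: by apply/eqP; rewrite -subr_eq0; apply/eqP; case: (Zs t u).
Qed.

Lemma center_subring : is_subring (center A).
Proof.
split.
- by apply/centerP; split=> *; rewrite ?mulg1 ?mul1g.
- move=> s t /centerP[C1 C2 C3 C4] /centerP[D1 D2 D3 D4].
  apply/centerP; split=> [u|u v|u v|u v]; rewrite !(namulBl, namulBr).
  + by rewrite C1 D1.
  + by rewrite C2 D2.
  + by rewrite C3 D3.
  + by rewrite C4 D4.
move=> s t /centerP[C1 C2 C3 C4] /centerP[D1 D2 D3 D4]; apply/centerP.
have E1 u : (s * t * u)%g = (u * (s * t))%g by rewrite C2 D1 -C2 C1 D4.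
split=> // u v.
- by rewrite !C2 D2.
- by rewrite -D4 D3 C3 C2.
by rewrite -D4 C4 !D4.
Qed.

(** A central [s <> 0] generates the ideal [s A], so [s t = 1] for some [t].
    Multiplication by [s] is then injective, and each identity that makes [t]
    central follows by multiplying it by [s] and moving [s] next to [t]. *)
Lemma simple_center_field :
  is_simple A -> (1%g : A) <> 0 -> is_field (center A).
Proof.
move=> simA n10; split=> //; first exact: center_subring.
- by move=> x y z /centerP[] _ C2 _ _ _ _; rewrite C2.
- by move=> x y /centerP[].
move=> s Zs s0; have [C1 C2 C3 C4] := (centerP s).1 Zs.
have idJ : is_ideal [set (s * u)%g | u in setT].
  split.
  - by exists 0; rewrite // namulr0.
  - by move=> _ _ [u _ <-] [v _ <-]; exists (u - v); rewrite // namulBr.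
  - move=> r _ [u _ <-]; split.
    + by exists (r * u)%g => //; rewrite -C2 C1 C3.
    + by exists (u * r)%g => //; rewrite C2.
have [t _ st1] : [set (s * u)%g | u in setT] 1%g.
  case: (simA _ idJ) => [J0|->//].
  have : [set (s * u)%g | u in setT] s by exists 1%g; rewrite ?mulg1.
  by rewrite J0.
have stK u : (s * (t * u))%g = u by rewrite -C2 st1 mul1g.
have sI u v : (s * u)%g = (s * v)%g -> u = v.
  by move=> suv; rewrite -(stK u) -(stK v) -!C2 [(s * t)%g]C1 !C3 suv.
have tC u : (t * u)%g = (u * t)%g.
  by apply: sI; rewrite stK -C2 C1 C3 st1 mulg1.
exists t => //; apply/centerP.
have tA u v : (t * u * v)%g = (t * (u * v))%g.
  by apply: sI; rewrite stK -C2 stK.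
split=> // u v.
  apply: sI; rewrite -!tC -C2 stK -[in RHS]C2 [(s * u)%g]C1 C3 -C2 st1.
  by rewrite mul1g.
by rewrite -!tC; apply: sI; rewrite stK -C2 C1 C3 stK.
Qed.

End NonAssociative.

(** * Exponents and multinomial coefficients *)

Section Exponents.
Context {I : choiceType}.
Implicit Types f g h m : {cmonom I}.

Lemma mle_refl f : mle f f. Proof. by move=> i. Qed.

Lemma mle_trans f g h : mle f g -> mle g h -> mle f h.
Proof. by move=> fg gh i; exact: leq_trans (fg i) (gh i). Qed.

Lemma mle1 f : mle f 1%M -> f = 1%M.
Proof.
by move=> f1; apply/eqP/cmP=> i; move: (f1 i); rewrite cm1 leqn0 => /eqP.
Qed.

Lemma eqm_mul2l g f f' : (g * f == g * f')%M = (f == f').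
Proof.
apply/eqP/eqP => [/eqP/cmP E|->//]; apply/eqP/cmP => i; have := E i.
by rewrite !cmM => /addnI.
Qed.

Lemma mle_mdeg f g : mle f g -> (mdeg g <= mdeg f)%N -> f = g.
Proof.
move=> fg; have -> : g = (divcm g f * f)%M.
  by apply/eqP/cmP => i; rewrite cmM divcmE subnK.
rewrite mdegM -[X in (_ <= X)%N]add0n leq_add2r leqn0 mdeg_eq0 => /eqP ->.
by rewrite mul1m.
Qed.

Lemma divcmUK i f : f i != 0%N -> f = (U_(i) * divcm f U_(i))%M.
Proof.
move=> fi; apply/eqP/cmP => j; rewrite cmM divcmE cmU; case: eqVneq => [<-|_].
  by rewrite subnKC// lt0n.
by rewrite subn0.
Qed.

Lemma cmonom_ind (P : {cmonom I} -> Prop) :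
  P 1%M -> (forall i f, P f -> P (U_(i) * f)%M) -> forall f, P f.
Proof.
move=> P1 PM f; have [n] := ubnP (mdeg f); elim: n f => // n IH f.
have [->//|/negP f1] := eqVneq f 1%M.
have [i fi] : exists i, f i != 0%N.
  apply/not_existsP => f0; apply/f1/cmP => i; rewrite cm1; apply/eqP.
  by apply/negPn/negP/f0.
by rewrite (divcmUK fi) mdegM mdegU ltnS => lt_n; apply: PM; apply: IH.
Qed.

Lemma mbinomw f g (L : {fset I}) :
  (finsupp f `<=` L)%fset -> (finsupp g `<=` L)%fset ->
  mbinom f g = (\prod_(i <- L) 'C(f i, g i))%N.
Proof.
move=> fL gL; apply: big_fset_incl; first by rewrite fsubUset fL gL.
move=> i _; rewrite inE negb_or => /andP[].
by rewrite -!cmE_eq0 => /eqP -> /eqP ->.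
Qed.

Lemma mbinom_out f g : ~ mle g f -> mbinom f g = 0%N.
Proof.
move=> /existsNP[i /negP]; rewrite -ltnNge => fg.
have iL : i \in (finsupp f `|` finsupp g)%fset.
  by rewrite inE -[X in _ || X]cmE_neq0 -lt0n (leq_ltn_trans _ fg) ?orbT.
by rewrite /mbinom (big_fsetD1 i iL)/= bin_small.
Qed.

(** Pascal's rule in the [i]-th factor, the other factors being unchanged. *)
Lemma mbinom_pascal i f g :
  mbinom (U_(i) * f)%M (U_(i) * g)%M = (mbinom f g + mbinom f (U_(i) * g)%M)%N.
Proof.
pose L := (i |` (finsupp f `|` finsupp g))%fset.
have subL m : (finsupp m `<=` finsupp f `|` finsupp g)%fset ->
    (finsupp m `<=` L)%fset /\ (finsupp (U_(i) * m)%M `<=` L)%fset.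
  move=> mL; have mL' : (finsupp m `<=` L)%fset.
    exact: fsubset_trans mL (fsubsetUr _ _).
  by split; rewrite // mdomD fsubUset mL' mdomU fsub1set !inE eqxx.
have [fL UfL] := subL f (fsubsetUl _ _).
have [gL UgL] := subL g (fsubsetUr _ _).
have iL : i \in L by rewrite !inE eqxx.
rewrite !(mbinomw (L := L))// !(big_fsetD1 i iL)/= !cmM !cmUU !add1n binS addnC.
rewrite mulnDl; congr (_ * _ + _ * _)%N; apply: eq_fbigr => j;
  by rewrite !inE => /andP[/negPf ji _]; rewrite !cmM !cmU eq_sym ji.
Qed.

Lemma mbinomU0 i f g : g i = 0%N -> mbinom (U_(i) * f)%M g = mbinom f g.
Proof.
move=> gi; pose L := (i |` (finsupp f `|` finsupp g))%fset.
have iL : i \in L by rewrite !inE eqxx.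
have fL : (finsupp f `<=` L)%fset.
  exact: fsubset_trans (fsubsetUl _ _) (fsubsetUr _ _).
have gL : (finsupp g `<=` L)%fset.
  exact: fsubset_trans (fsubsetUr _ _) (fsubsetUr _ _).
rewrite !(mbinomw (L := L))//; last first.
  by rewrite mdomD fsubUset mdomU fsub1set iL fL.
apply: eq_bigr => j _; rewrite cmM cmU.
by case: eqVneq => [<-|//]; rewrite gi !bin0.
Qed.

End Exponents.

(** * Iterated maps and Pascal's rule *)

Section Powers.
Context {d : Order.disp_t} {I : orderType d} {R : naRingType}.
Context (delta : I -> {additive R -> R}).
Implicit Types (f g h k : {cmonom I}) (r s : R).

Local Notation compose f := (foldr (fun i => iter (f i) (delta i))).

(** Enlarging the list of indices beyond the support of [f] only inserts
    identity maps; this puts two powers over a common list. *)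
Lemma dpowEw f (L : {fset I}) r :
  (finsupp f `<=` L)%fset -> dpow delta f r = compose f r (sort <=%O L).
Proof.
move=> fL; have -> : dpow delta f r =
    compose f r [seq i <- sort <=%O L | i \in finsupp f].
  rewrite /dpow filter_sort//; [|exact: le_total|exact: le_trans].
  congr foldr; apply/perm_sort_leP; apply: uniq_perm.
  - exact: fset_uniq.
  - by rewrite filter_uniq ?fset_uniq.
  move=> i; rewrite mem_filter andbC; case: (boolP (i \in L)) => //= iL.
  by apply: contraNF iL; apply: (fsubsetP fL).
elim: (sort _ _) => //= i l IH; rewrite -cmE_neq0.
by case: eqP => [-> //|_] /=; rewrite IH.
Qed.

Lemma dpi_one f h : (forall i, delta i 1%g = 0) -> h != f ->
  dpi delta f h 1%g = 0.
Proof.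
move=> delta1 hf; rewrite /dpi; case: asboolP => // le_hf.
rewrite dpow1_eq0 ?mul0rn//; apply: contra_neq hf => /eqP/cmP fh1.
apply/eqP/cmP => i; apply/eqP; rewrite eqn_leq le_hf/=.
by rewrite -subn_eq0 -divcmE fh1 cm1.
Qed.

Context (deltaC : commutative_family delta).

Lemma composeC i f r (l : seq I) :
  delta i (compose f r l) = compose f (delta i r) l.
Proof.
elim: l => //= j l <-; elim: (f j) => //= n <-.
exact: deltaC.
Qed.

(** The extra factor [delta i] sits inside the composite at the place of [i]; it
    commutes past the maps of the later indices and reaches the argument. *)
Lemma dpowUM i f r : dpow delta (U_(i) * f)%M r = dpow delta f (delta i r).
Proof.
pose L := finsupp (U_(i) * f)%M.
have uL : uniq (sort <=%O L) by rewrite sort_uniq fset_uniq.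
have iL : i \in sort <=%O L by rewrite mem_sort /L mdomD mdomU !inE eqxx.
rewrite [LHS](@dpowEw _ L)// [RHS](@dpowEw _ L); last first.
  by rewrite /L mdomD fsubsetUr.
elim: (sort _ _) iL uL => //= j l IH; rewrite inE cmM cmU.
have [<- _|ij /= il] := eqVneq i j; last by case/andP=> _ /(IH il) ->.
case/andP=> il _; rewrite add1n iterSr -composeC; congr (iter _ _ (delta i _)).
elim: l il {IH} => //= k l IH; rewrite inE negb_or => /andP[/negPf ik /IH ->].
by rewrite cmM cmU ik.
Qed.

Lemma dpowC i f r : delta i (dpow delta f r) = dpow delta f (delta i r).
Proof. exact: composeC. Qed.

Lemma dpiE f g r : dpi delta f g r = dpow delta (divcm f g) r *+ mbinom f g.
Proof.
by rewrite /dpi; case: asboolP => // /mbinom_out ->; rewrite mulr0n.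
Qed.

Lemma dpiC i f g r : delta i (dpi delta f g r) = dpi delta f g (delta i r).
Proof. by rewrite !dpiE raddfMn/= dpowC. Qed.

(** Pascal's rule for the maps [pi].  With [dpiU0] it gives the coefficients of
    [x^(f + e_i) r = x^f (x_i r)]. *)
Lemma dpiUM i f g r : dpi delta (U_(i) * f)%M (U_(i) * g)%M r =
  dpi delta f g r + dpi delta f (U_(i) * g)%M (delta i r).
Proof.
rewrite !dpiE mbinom_pascal mulrnDr -dpowUM; congr (_ + _).
  congr (dpow _ _ _ *+ _); apply/eqP/cmP => j.
  by rewrite !divcmE !cmM subnDl.
(* Truncated subtraction is exact here: otherwise the binomial is zero. *)
have [le_gf|/mbinom_out->//] := pselect (mle (U_(i) * g)%M f).
congr (dpow _ _ _ *+ _); apply/eqP/cmP => j.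
by rewrite cmM !divcmE !cmM addnBA// -cmM.
Qed.

Lemma dpiU0 i f g r : g i = 0%N ->
  dpi delta (U_(i) * f)%M g r = dpi delta f g (delta i r).
Proof.
move=> gi; rewrite !dpiE mbinomU0// -dpowUM.
have [le_gf|/mbinom_out->//] := pselect (mle g f).
congr (dpow _ _ _ *+ _); apply/eqP/cmP => j.
by rewrite cmM !divcmE !cmM addnBA.
Qed.

Lemma dpi1 k r : dpi delta 1%M k r = r *+ (k == 1%M).
Proof.
case: eqP => [->|k1]; first by rewrite dpi_id.
by rewrite dpi_out// => /mle1.
Qed.

Lemma dpiU i k r : dpi delta U_(i)%M k r =
  r *+ (k == U_(i)%M) + delta i r *+ (k == 1%M).
Proof.
have [ki|/[dup] ki /divcmUK kE] := eqVneq (k i) 0%N.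
  rewrite -[U_(i)%M]mulm1 dpiU0// dpi1 mulm1.
  by case: (k =P U_(i)%M) ki => [->|_]; rewrite ?cmUU ?add0r.
rewrite kE; move: (divcm k _) => {kE ki}k.
by rewrite -{1 4}[U_(i)%M]mulm1 dpiUM !dpi1 eqm_mul2l cmM_eq1 cm1_eq1.
Qed.

End Powers.

(** * Multiplication by constants and monomials *)

(** [T] is, as an additive group, the free sum of copies of [R] indexed by the
    exponents, and multiplies like [R[N^(I); pi]].  The arguments below use
    nothing else, in particular no representation of elements by functions. *)
Record diff_ring_basis {d : Order.disp_t} {I : orderType d} {R : naRingType}
    (delta : I -> {additive R -> R}) (T : naRingType)
    (mono : R -> {cmonom I} -> T) (coef : {cmonom I} -> {additive T -> R})
  : Prop := DiffRingBasis {
  mono_one : mono 1%g 1%M = 1%g;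
  coef_mono : forall r f g, coef g (mono r f) = r *+ (f == g);
  coefP : forall u v, (forall f, coef f u = coef f v) -> u = v;
  coef_finite : forall u, exists L : {fset {cmonom I}},
    forall f, f \notin L -> coef f u = 0;
  monoM : forall r f s g, (mono r f * mono s g)%g =
    \sum_(h <- fset_set [set h | mle h f])
       mono (r * dpi delta f h s)%g (h * g)%M
}.

Section DiffRing.
Context {d : Order.disp_t} {I : orderType d} {R : naRingType}.
Context (delta : I -> {additive R -> R}) (delta1 : forall i, delta i 1%g = 0).
Context (S : naRingType) (mono : R -> {cmonom I} -> S).
Context (coef : {cmonom I} -> {additive S -> R}).
Context (basis : diff_ring_basis delta mono coef).
Implicit Types (f g h k : {cmonom I}) (r s t : R) (a b u v w : S).

Local Notation C r := (mono r 1%M).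
Local Notation X f := (mono 1%g f).

Let coef_mono := coef_mono basis.
Let coefP := coefP basis.
Let monoM := monoM basis.

Lemma mono0 f : mono 0 f = 0.
Proof. by apply: coefP => g; rewrite coef_mono mul0rn raddf0. Qed.

Lemma coef_monoE r f : coef f (mono r f) = r.
Proof. by rewrite coef_mono eqxx. Qed.

Definition supported u (D : {fset {cmonom I}}) :=
  forall f, f \notin D -> coef f u = 0.

Lemma mono_expansion u (L : {fset {cmonom I}}) :
  supported u L -> u = \sum_(f <- L) mono (coef f u) f.
Proof.
move=> uL; apply: coefP => g; rewrite raddf_sum/=.
have [gL|gL] := boolP (g \in L).
  rewrite (big_fsetD1 g gL)/= coef_monoE big1_fset ?addr0// => h.
  by rewrite !inE coef_mono => /andP[/negPf ->].
rewrite uL// big_seq big1// => h hL; rewrite coef_mono.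
by case: eqP hL gL => [->|//] ->.
Qed.

Lemma mono_ind (P : S -> Prop) :
  (forall u v, P u -> P v -> P (u + v)) -> (forall r f, P (mono r f)) ->
  forall u, P u.
Proof.
move=> PD PM u; have [L uL] := coef_finite basis u.
rewrite (mono_expansion uL); apply: (big_ind P) => //.
by rewrite -(mono0 1%M).
Qed.

Lemma constM_mono r s g : (C r * mono s g)%g = mono (r * s)%g g.
Proof.
rewrite monoM (_ : fset_set _ = [fset 1%M]%fset).
  by rewrite big_seq_fset1 dpi_id mul1m.
apply/fsetP => h; rewrite in_fset_set; last exact: finite_mle.
rewrite !inE; apply/asboolP/eqP => [/mle1//|->]; exact: mle_refl.
Qed.

Lemma mem_lower f h : (h \in fset_set [set h | mle h f]) = `[< mle h f >].
Proof. by rewrite in_fset_set ?inE//; exact: finite_mle. Qed.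

Lemma coef_monoMconst r f s k :
  coef k (mono r f * C s)%g = (r * dpi delta f k s)%g.
Proof.
rewrite monoM raddf_sum/=; under eq_bigr do rewrite mulm1 coef_mono.
have [kf|nkf] := asboolP (mle k f); last first.
  rewrite dpi_out// namulr0 big_seq big1// => h.
  rewrite mem_lower => /asboolP hf.
  by case: eqP hf nkf => [->|].
have kS : k \in fset_set [set h | mle h f] by rewrite mem_lower; apply/asboolP.
rewrite (big_fsetD1 k kS)/= eqxx big1_fset ?addr0// => h.
by rewrite !inE => /andP[/negPf ->].
Qed.

(** Only the term [h = f] survives, since [delta_i(1) = 0]. *)
Lemma monoMX r f g : (mono r f * X g)%g = mono r (f * g)%M.
Proof.
have fS : f \in fset_set [set h | mle h f] by rewrite mem_lower; apply/asboolP.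
rewrite monoM (big_fsetD1 f fS)/= dpi_id mulg1 big1_fset ?addr0// => h.
by rewrite !inE => /andP[hf _] _; rewrite dpi_one// namulr0 mono0.
Qed.

Lemma mulXX f g : (X f * X g)%g = X (f * g)%M. Proof. exact: monoMX. Qed.

Lemma constMX r f : (C r * X f)%g = mono r f.
Proof. by rewrite constM_mono mulg1. Qed.

Lemma monoM_left r f u : (mono r f * u)%g = (C r * (X f * u))%g.
Proof.
elim/mono_ind: u => [u v IHu IHv|s g]; first by rewrite !namulDr IHu IHv.
rewrite !monoM namul_sumr; apply: eq_bigr => h _.
by rewrite constM_mono mul1g.
Qed.

(** Right multiplication by [X g] merely shifts exponents. *)
Lemma X_right_nucleus u v g : (u * v * X g)%g = (u * (v * X g))%g.
Proof.
elim/mono_ind: u => [u u' IHu IHu'|r f]; first by rewrite !namulDl IHu IHu'.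
elim/mono_ind: v => [v v' IHv IHv'|s h].
  by rewrite namulDr !namulDl IHv IHv' namulDr.
rewrite monoMX !monoM namul_suml; apply: eq_bigr => k _.
by rewrite monoMX mulmA.
Qed.

Lemma coef_constM r u k : coef k (C r * u)%g = (r * coef k u)%g.
Proof.
elim/mono_ind: u => [u v IHu IHv|s g].
  by rewrite namulDr !raddfD/= IHu IHv namulDr.
by rewrite constM_mono !coef_mono namulMnr.
Qed.

Lemma coef_Mconst u s k (L : {fset {cmonom I}}) :
  supported u L ->
  coef k (u * C s)%g = \sum_(f <- L) (coef f u * dpi delta f k s)%g.
Proof.
move=> uL; rewrite {1}(mono_expansion uL) namul_suml raddf_sum/=.
by apply: eq_bigr => f _; rewrite coef_monoMconst.
Qed.

Context (deltaC : commutative_family delta).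

Lemma XUM_mono i r f :
  (X U_(i)%M * mono r f)%g = mono r (U_(i) * f)%M + mono (delta i r) f.
Proof.
rewrite -[mono r f]constMX -X_right_nucleus.
have -> : (X U_(i)%M * C r)%g = mono r U_(i)%M + C (delta i r).
  apply: coefP => k; rewrite coef_monoMconst mul1g raddfD/= !coef_mono.
  by rewrite dpiU// ![k == _]eq_sym.
by rewrite namulDl !monoMX mul1m.
Qed.

Definition XU_comm i u : S := (X U_(i)%M * u)%g - (u * X U_(i)%M)%g.

(** [x_i u = u x_i + delta_i(u)], with [delta_i] applied to coefficients: the
    commutators with the variables extend the family Delta to [S]. *)
Lemma coef_XU_comm i f u : coef f (XU_comm i u) = delta i (coef f u).
Proof.
rewrite /XU_comm; elim/mono_ind: u => [u v IHu IHv|r g].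
  by rewrite namulDr namulDl opprD addrACA [LHS]raddfD/= IHu IHv !raddfD.
by rewrite XUM_mono monoMX mulmC addrC addKr !coef_mono raddfMn.
Qed.

Lemma coef_MXU i u k : coef (U_(i) * k)%M (u * X U_(i)%M)%g = coef k u.
Proof.
elim/mono_ind: u => [u v IHu IHv|r f].
  by rewrite namulDl !raddfD/= IHu IHv.
by rewrite monoMX !coef_mono mulmC eqm_mul2l.
Qed.

Lemma coef_MXU0 i u k : k i = 0%N -> coef k (u * X U_(i)%M)%g = 0.
Proof.
move=> ki; elim/mono_ind: u => [u v IHu IHv|r f].
  by rewrite namulDl raddfD/= IHu IHv addr0.
rewrite monoMX coef_mono; case: eqP => // E.
by move: ki; rewrite -E cmM cmUU addn1.
Qed.

(** On coefficients this is Pascal's rule [dpiUM]. *)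
Lemma XU_middle_nucleus_mono i r f s :
  (mono r f * X U_(i)%M * C s)%g = (mono r f * (X U_(i)%M * C s))%g.
Proof.
rewrite XUM_mono mulm1 monoMX namulDr -[mono s U_(i)%M]constMX -X_right_nucleus.
apply: coefP => k; rewrite raddfD/= !coef_monoMconst mulmC.
have [ki|ki] := eqVneq (k i) 0%N.
  by rewrite coef_MXU0// add0r dpiU0.
by rewrite (divcmUK ki) coef_MXU coef_monoMconst dpiUM// namulDr.
Qed.

(** The general case follows from that of one variable: the middle nucleus is
    additive in the outer factors, and the right nucleus strips the power of
    the last one. *)
Lemma X_middle_nucleus u f v : (u * X f * v)%g = (u * (X f * v))%g.
Proof.
elim/(@cmonom_ind I): f u v => [|i f IH] u v.
  by rewrite (mono_one basis) mulg1 mul1g.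
have E w z : (w * X U_(i)%M * z)%g = (w * (X U_(i)%M * z))%g.
  elim/mono_ind: z => [v1 v2 E1 E2|s g]; first by rewrite !namulDr E1 E2.
  rewrite -[mono s g]constMX -!X_right_nucleus; congr (_ * _)%g.
  elim/mono_ind: w => [v1 v2 E1 E2|r k]; first by rewrite !namulDl E1 E2.
  exact: XU_middle_nucleus_mono.
by rewrite -mulXX -[(u * _)%g]X_right_nucleus !IH E.
Qed.

Lemma kernelP r : kernel delta r <-> forall i, delta i r = 0.
Proof. by split=> [Kr i|Kr i _]; [exact: Kr|exact: Kr]. Qed.

Lemma XU_comm_const i r : XU_comm i (C r) = C (delta i r).
Proof. by apply: coefP => f; rewrite coef_XU_comm !coef_mono raddfMn. Qed.

Lemma XUM_comm i u : (X U_(i)%M * u)%g = (u * X U_(i)%M)%g + XU_comm i u.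
Proof. by rewrite addrC subrK. Qed.

(** * A criterion for centrality *)

Section Central.
Context (a : S) (a_kernel : forall f, kernel delta (coef f a)).
Context (aC : forall r, (C r * a)%g = (a * C r)%g).
Context (aCC : forall r s, (a * C r * C s)%g = (a * (C r * C s))%g).
Context (CaC : forall r s, (C r * a * C s)%g = (C r * (a * C s))%g).

Lemma XU_commute i : (X U_(i)%M * a)%g = (a * X U_(i)%M)%g.
Proof.
rewrite XUM_comm (_ : XU_comm i a = 0) ?addr0//; apply: coefP => f.
by rewrite coef_XU_comm raddf0; move/kernelP: (a_kernel f).
Qed.

Lemma X_commute f : (X f * a)%g = (a * X f)%g.
Proof.
elim/(@cmonom_ind I): f => [|i f IH].
  by rewrite (mono_one basis) mulg1 mul1g.
rewrite -mulXX X_middle_nucleus IH -X_right_nucleus.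
by rewrite XU_commute X_right_nucleus.
Qed.

Lemma central_comm u : (a * u)%g = (u * a)%g.
Proof.
elim/mono_ind: u => [u v IHu IHv|r f]; first by rewrite namulDl namulDr IHu IHv.
by rewrite monoM_left X_commute -X_right_nucleus aC X_right_nucleus constMX.
Qed.

Lemma constM_left_nucleus r u : (a * C r * u)%g = (a * (C r * u))%g.
Proof.
elim/mono_ind: u => [u v IHu IHv|s f]; first by rewrite !namulDr IHu IHv.
by rewrite -[mono s f]constMX -!X_right_nucleus aCC.
Qed.

Lemma const_middle_nucleus r u : (C r * a * u)%g = (C r * (a * u))%g.
Proof.
elim/mono_ind: u => [u v IHu IHv|s f]; first by rewrite !namulDr IHu IHv.
by rewrite -[mono s f]constMX -!X_right_nucleus CaC.
Qed.

Lemma central_left_nucleus u v : (a * u * v)%g = (a * (u * v))%g.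
Proof.
elim/mono_ind: u => [u w IHu IHw|r f].
  by rewrite !(namulDl, namulDr) IHu IHw.
rewrite monoM_left -constM_left_nucleus -X_middle_nucleus.
by rewrite X_right_nucleus constMX.
Qed.

(** Left and right kernel derivations act differently here: the commutator with
    [x_i] is linear for left multiplication by [a] in the former case, for right
    multiplication by [a] in the latter, and in the latter commutation with [a]
    is used to exchange the two sides.  The powers being in the right nucleus,
    it suffices to treat a constant [u]. *)
Lemma XU_central i u :
  left_kernel_derivations delta \/ right_kernel_derivations delta ->
  (X U_(i)%M * (a * u))%g = (a * (X U_(i)%M * u))%g.
Proof.
move=> kder; elim/mono_ind: u => [u v IHu IHv|r f].
  by rewrite !namulDr IHu IHv.
rewrite -[mono r f]constMX -!X_right_nucleus; congr (_ * _)%g.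
case: kder => [lder|rder].
  rewrite !XUM_comm namulDr X_right_nucleus XU_comm_const; congr (_ + _).
  have [L aL] := coef_finite basis a.
  apply: coefP => k; rewrite coef_XU_comm !(coef_Mconst _ _ aL) raddf_sum.
  by apply: eq_bigr => f' _; rewrite /= lder// dpiC.
rewrite -aC XUM_comm X_right_nucleus -XU_commute -X_middle_nucleus.
have -> : XU_comm i (C r * a)%g = (C (delta i r) * a)%g.
  by apply: coefP => k; rewrite coef_XU_comm !coef_constM rder.
by rewrite -namulDl -XU_comm_const -XUM_comm central_comm.
Qed.

(** Every element is a sum of products of [C r] and [X f], so the relations of
    [a] with constants spread to [S].  Commutation and membership in the left
    nucleus follow from the nuclei of the powers, membership in the middle
    nucleus from [XU_central], and in the right nucleus by commutation. *)
Lemma kernel_central :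
  left_kernel_derivations delta \/ right_kernel_derivations delta -> center S a.
Proof.
move=> kder; have XaM f u : (X f * (a * u))%g = (a * (X f * u))%g.
  elim/(@cmonom_ind I): f u => [|i f IH] u.
    by rewrite (mono_one basis) !mul1g.
  by rewrite -mulXX !X_middle_nucleus IH XU_central.
have aM u v : (u * a * v)%g = (u * (a * v))%g.
  elim/mono_ind: u => [u w IHu IHw|r f]; first by rewrite !namulDl IHu IHw.
  rewrite [in LHS]monoM_left [RHS]monoM_left XaM X_commute.
  by rewrite -X_right_nucleus X_middle_nucleus const_middle_nucleus.
apply/centerP; split=> [u|u v|u v|u v] //.
- exact: central_comm.
- exact: central_left_nucleus.
by rewrite -!central_comm -central_left_nucleus central_comm aM.
Qed.

End Central.

(** * Ideals given by coefficients *)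

Section Ideals.
Context (J : set R) (idJ : is_ideal J).
Context (deltaJ : forall i, delta i @` J `<=` J).

Lemma dpi_ideal f g r : J r -> J (dpi delta f g r).
Proof.
move=> Jr; have J0 : J 0 by case: idJ.
rewrite dpiE; elim: (mbinom f g) => [|n IH]; rewrite ?mulr0n// mulrS.
apply: idealD => //; rewrite /dpow.
elim: (sort _ _) => //= i l Jl; elim: (divcm f g i) => //= m Jm.
by apply: deltaJ; eexists; [exact: Jm|].
Qed.

Lemma coef_monoM_ideal r f s g k :
  J r \/ J s -> J (coef k (mono r f * mono s g)%g).
Proof.
move=> Jrs; rewrite monoM raddf_sum; apply: ideal_sum => // h /=.
rewrite coef_mono; case: (_ == k); last by rewrite mulr0n; case: idJ.
rewrite mulr1n; case: idJ => _ _ JM.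
case: Jrs => [/JM Jr|/(dpi_ideal f h)/JM Js].
  by case: (Jr (dpi delta f h s)).
by case: (Js r).
Qed.

Lemma ideal_coef : is_ideal [set u | forall f, J (coef f u)].
Proof.
have [J0 JB JM] := idJ; split=> [f|u v Ju Jv f|].
- by rewrite raddf0.
- by rewrite raddfB; apply: JB.
move=> w u Ju; have [L uL] := coef_finite basis u; rewrite (mono_expansion uL).
elim/mono_ind: w => [w w' [Jw Jw'] [Iw Iw']|r g].
  by split=> f; rewrite ?namulDl ?namulDr raddfD; apply: idealD.
split=> f; rewrite ?namul_sumr ?namul_suml raddf_sum; apply: ideal_sum => // h.
  by apply: coef_monoM_ideal; right.
by apply: coef_monoM_ideal; left.
Qed.

End Ideals.

Lemma simple_delta_simple : is_simple S -> delta_simple delta.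
Proof.
move=> simS J idJ deltaJ; have [J0 _ _] := idJ.
have JC r : J r -> forall f, J (coef f (C r)).
  by move=> Jr f; rewrite coef_mono; case: (_ == _).
have [JS|JS] := simS _ (ideal_coef idJ deltaJ).
  left; apply/seteqP; split=> [r Jr|_ ->//] /=.
  have : [set u | forall f, J (coef f u)] (C r) by exact: JC.
  by rewrite JS /= => Cr0; rewrite -(coef_monoE r 1%M) Cr0 raddf0.
right; apply: ideal1 => //.
have : [set u | forall f, J (coef f u)] 1%g by rewrite JS.
by move=> /(_ 1%M); rewrite -(mono_one basis) coef_monoE.
Qed.

(** * Ideal elements of minimal support *)

Section MinimalSupport.
Context (J : set S) (idJ : is_ideal J).

Definition lower_set (D : {fset {cmonom I}}) :=
  forall f h, f \in D -> mle h f -> h \in D.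

(** [D] is a downward closed set of least cardinality carrying a nonzero
    element of [J], and [m] an element of [D] of greatest total degree. *)
Lemma minimal_support : (exists2 u, J u & u <> 0) ->
  exists D m, [/\ lower_set D, exists2 u, J u & supported u D /\ u <> 0,
    forall f, f \in D -> mle m f -> f = m &
    forall u, J u -> supported u D -> coef m u = 0 -> u = 0].
Proof.
move=> [u0 Ju0 u0N0].
pose P n := `[< exists D, [/\ #|` D| = n, lower_set D &
   exists2 u, J u & supported u D /\ u <> 0] >].
have exP : exists n, P n.
  have [L u0L] := coef_finite basis u0.
  pose D := fset_set (\bigcup_(f in [set` L]) [set h | mle h f]).
  have DE f : (f \in D) = `[< exists2 g, g \in L & mle f g >].
    rewrite in_fset_set; last first.
      by apply: bigcup_finite => [|g _]; [exact: finite_fset|exact: finite_mle].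
    apply/idP/asboolP => [/set_mem[g gL fg]|[g gL fg]]; first by exists g.
    by apply/mem_set; exists g.
  exists #|` D|; apply/asboolP; exists D; split=> //.
    move=> f h; rewrite !DE => /asboolP[g gL fg] hf; apply/asboolP.
    by exists g => //; exact: mle_trans hf fg.
  exists u0 => //; split=> // f; rewrite DE => /asboolPn fD.
  apply: u0L; apply: contra_notN fD => fL; exists f => //; exact: mle_refl.
have [n /asboolP[D [Dn Dl Du]] minD] := ex_minnP exP.
have [m0 m0D] : exists m, m \in D.
  have [u _ [uD uN0]] := Du; apply/not_existsP => D0; apply: uN0.
  by apply: coefP => f; rewrite uD ?raddf0//; apply/negP/D0.
have [m mD mmax] :
    exists2 m, m \in D & forall f, f \in D -> (mdeg f <= mdeg m)%N.
  have [//|m _ mm] :=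
    @arg_maxnP D [` m0D]%fset xpredT (fun f : D => mdeg (val f)).
  by exists (val m); [exact: valP|move=> f fD; exact: (mm [` fD]%fset)].
have maxm f : f \in D -> mle m f -> f = m.
  by move=> fD mf; rewrite (mle_mdeg mf)// mmax.
exists D, m; split=> // u Ju uD um0; apply: contrapT => uN0.
suff : P #|` (D `\ m)%fset|.
  by move/minD; rewrite -Dn (cardfsD1 m D) mD add1n ltnn.
apply/asboolP; exists (D `\ m)%fset; split=> // [f h|].
  rewrite !inE => /andP[fm fD] hf; rewrite (Dl f)// andbT.
  by apply: contra_neq fm => hm; apply: maxm; rewrite // -hm.
exists u => //; split=> // f; rewrite !inE negb_and negbK.
by case/orP=> [/eqP->//|]; exact: uD.
Qed.

Context (D : {fset {cmonom I}}) (m : {cmonom I}) (Dlower : lower_set D).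
Context (mmax : forall f, f \in D -> mle m f -> f = m).

Lemma supportedB u v : supported u D -> supported v D -> supported (u - v) D.
Proof. by move=> uD vD f fD; rewrite raddfB/= uD// vD// subrr. Qed.

Lemma supported_constM r u : supported u D -> supported (C r * u)%g D.
Proof. by move=> uD f fD; rewrite coef_constM uD// namulr0. Qed.

(** [x^f r] involves only exponents below [f]. *)
Lemma supported_Mconst r u : supported u D -> supported (u * C r)%g D.
Proof.
move=> uD k kD; rewrite (coef_Mconst _ _ uD) big_seq big1// => f fD.
by rewrite dpi_out ?namulr0// => kf; case/negP: kD; exact: Dlower kf.
Qed.

Lemma supported_XU_comm i u : supported u D -> supported (XU_comm i u) D.
Proof. by move=> uD f fD; rewrite coef_XU_comm uD// raddf0. Qed.

(** By maximality of [m], no other exponent of [D] contributes to [x^m]. *)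
Lemma coef_max_Mconst r u :
  supported u D -> coef m (u * C r)%g = (coef m u * r)%g.
Proof.
move=> uD; rewrite (coef_Mconst _ _ uD); have [mD|mD] := boolP (m \in D).
  rewrite (big_fsetD1 m mD)/= dpi_id big1_fset ?addr0// => f.
  rewrite !inE => /andP[/eqP fm fD] _; rewrite dpi_out ?namulr0// => mf.
  exact/fm/mmax.
rewrite uD// namul0r big_seq big1// => f fD.
by rewrite dpi_out ?namulr0// => mf; case/negP: mD; exact: Dlower mf.
Qed.

Lemma leading_ideal :
  is_ideal [set coef m u | u in [set u | J u /\ supported u D]].
Proof.
have [J0 JB JM] := idJ; split.
- by exists 0; [split=> // f _|]; rewrite raddf0.
- move=> _ _ [u [Ju uD] <-] [v [Jv vD] <-].
  exists (u - v); last by rewrite raddfB.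
  by split; [exact: JB|exact: supportedB].
move=> r _ [u [Ju uD] <-]; have [Jl Jr] := JM (C r) u Ju; split.
  exists (C r * u)%g; last by rewrite coef_constM.
  by split=> //; exact: supported_constM.
exists (u * C r)%g; last by rewrite coef_max_Mconst.
by split=> //; exact: supported_Mconst.
Qed.

Lemma XU_comm_ideal i u : J u -> J (XU_comm i u).
Proof.
move=> Ju; have [_ JB JM] := idJ; have [Jl Jr] := JM (X U_(i)%M) u Ju.
exact: JB.
Qed.

Lemma leading_ideal_delta i :
  let L := [set coef m u | u in [set u | J u /\ supported u D]] in
  delta i @` L `<=` L.
Proof.
move=> /= _ [_ [u [Ju uD] <-] <-].
exists (XU_comm i u); last exact: coef_XU_comm.
by split; [exact: XU_comm_ideal|exact: supported_XU_comm].
Qed.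

Context (m_determines :
  forall u, J u -> supported u D -> coef m u = 0 -> u = 0).

(** Each required identity holds between elements of [J] supported in [D], so
    it can be read off at [m], where [a] has coefficient [1]. *)
Lemma monic_central a :
    left_kernel_derivations delta \/ right_kernel_derivations delta ->
  J a -> supported a D -> coef m a = 1%g -> center S a.
Proof.
move=> kder Ja aD am1; have [_ JB JM] := idJ.
have JMl v u : J u -> J (v * u)%g by case/(JM v).
have JMr v u : J u -> J (u * v)%g by case/(JM v).
have eq_lead u v : J u -> J v -> supported u D -> supported v D ->
    coef m u = coef m v -> u = v.
  move=> Ju Jv uD vD uv; apply/eqP; rewrite -subr_eq0; apply/eqP.
  apply: m_determines; [exact: JB|exact: supportedB|].
  by rewrite raddfB/= uv subrr.
have sl := supported_constM; have sr := supported_Mconst.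
apply: kernel_central => //.
- move=> f; apply/kernelP => i; rewrite -coef_XU_comm.
  suff -> : XU_comm i a = 0 by rewrite raddf0.
  apply: m_determines; [exact: XU_comm_ideal|exact: supported_XU_comm|].
  by rewrite coef_XU_comm am1.
- move=> r; apply: eq_lead; [exact: JMl|exact: JMr|exact: sl|exact: sr|].
  by rewrite coef_constM coef_max_Mconst// am1 mul1g mulg1.
- move=> r s; apply: eq_lead; [exact/JMr/JMr|exact: JMr|exact/sr/sr| |].
    by rewrite constM_mono; exact: sr.
  rewrite constM_mono !coef_max_Mconst ?am1 ?mul1g//; exact: sr.
- move=> r s; apply: eq_lead.
  + exact/JMr/JMl.
  + exact/JMl/JMr.
  + exact/sr/sl.
  + exact/sl/sr.
  rewrite coef_constM !coef_max_Mconst ?coef_constM ?am1 ?mulg1 ?mul1g//.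
  exact: sl.
Qed.

End MinimalSupport.

Lemma delta_simple_simple :
  left_kernel_derivations delta \/ right_kernel_derivations delta ->
  delta_simple delta -> is_field (center S) -> is_simple S.
Proof.
move=> kder simR [_ _ _ _ Zinv] J idJ.
have [nzJ|zJ] := pselect (exists2 u, J u & u <> 0); last first.
  left; apply/seteqP; split=> [u Ju|_ ->]; last by case: idJ.
  by apply: contrapT => uN0; apply: zJ; exists u.
right; have [D [m [Dl [u Ju [uD uN0]] mmax mdet]]] := minimal_support nzJ.
have idL := leading_ideal idJ Dl mmax.
have [/seteqP[L0 _]|LT] := simR _ idL (@leading_ideal_delta J idJ D m).
  by case: uN0; apply: mdet => //; apply: L0; exists u.
have [a [Ja aD] am1] :
  [set coef m u | u in [set u | J u /\ supported u D]] 1%g by rewrite LT.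
have Za := monic_central idJ Dl mmax mdet kder Ja aD am1.
have [a0|aN0] := pselect (a = 0).
  case: uN0; apply: coefP => f; rewrite raddf0.
  by rewrite -(mulg1 (coef f u)) -am1 a0 raddf0 namulr0.
have [b _ ab1] := Zinv a Za aN0; apply: ideal1 => //.
by rewrite -ab1; case: idJ => _ _ /(_ b a Ja)[].
Qed.

End DiffRing.

(** * The differential monoid ring *)

Section DiffMonoidRing.
Context {d : Order.disp_t} {I : orderType d} {R : naRingType}.
Context (delta : I -> {additive R -> R}) (delta1 : forall i, delta i 1%g = 0).
Local Notation S := (diffMonoidRing delta1).

Definition monomial r (f : {cmonom I}) : S := << r *g f >>.
Definition coefficient (f : {cmonom I}) (u : S) : R := mcoeff f u.

Lemma coefficient_is_additive f : zmod_morphism (coefficient f).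
Proof. exact: mcoeffB. Qed.
HB.instance Definition _ f :=
  GRing.isZmodMorphism.Build S R (coefficient f) (coefficient_is_additive f).

Lemma monomial_basis : @diff_ring_basis _ _ _ delta S monomial coefficient.
Proof.
split=> //.
- by move=> r f g; exact: mcoeffU.
- by move=> u v /malgP.
- by move=> u; exists (msupp u) => f /mcoeff_outdom.
by move=> r f s g; rewrite -dtermE; exact: dmulUU.
Qed.

End DiffMonoidRing.

Theorem theorem24 (R : naRingType) (R_nontrivial : (1%g : R) <> 0)
    (d : Order.disp_t) (I : orderType d) (I_wo : well_order (<=%O : rel I))
    (delta : I -> {additive R -> R}) (delta1 : forall i, delta i 1%g = 0)
    (delta_kernel :
       (commutative_family delta /\ left_kernel_derivations delta) \/
       (commutative_family delta /\ right_kernel_derivations delta)) :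
  is_simple (diffMonoidRing delta1) <->
  delta_simple delta /\ is_field (center (diffMonoidRing delta1)).
Proof.
have deltaC : commutative_family delta by case: delta_kernel => [][].
have kder : left_kernel_derivations delta \/ right_kernel_derivations delta.
  by case: delta_kernel => [][]; [left|right].
have basis := monomial_basis delta1.
split=> [simS|[simR fieldZ]].
  split; first exact: simple_delta_simple basis simS.
  apply: simple_center_field => //.
  rewrite -(mono_one basis) => one0; apply: R_nontrivial.
  by rewrite -(coef_monoE basis 1%g 1%M) one0 raddf0.
exact: delta_simple_simple basis deltaC kder simR fieldZ.
Qed.
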